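(* Let $(\underline{C},w)$ be a weighted category. 1. For $U\in\mathrm{Obj}\,\underline{C}$ we have $U\in\underline{C}_{[0,1]}$ if and only if $U$ is a cone of some morphism $f$ of $\underline{Hw}$. Moreover, two objects of $\underline{C}_{[0,1]}$ are isomorphic if and only if the corresponding two-term complexes (given by $\underline{Hw}$-morphisms whose cones they are) are isomorphic in $\mathscr{K}(\underline{Hw})$, that is, homotopy equivalent. 2. Let $(\underline{C}',w')$ be a weighted category, and let $F:\underline{Hw}\to\underline{Hw}'$ be an additive functor that is an equivalence. Then there exists a unique bijection $\tilde F$ between the class of isomorphism classes of objects of $\underline{C}_{[0,1]}$ and that of $\underline{C}'_{[0,1]}$ such that for any $\underline{Hw}$-morphism $s$ we have $\tilde F([\mathrm{Cone}(s)])=[\mathrm{Cone}(F(s))]$.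
   Context: A weight structure $w$ on a triangulated category $\underline{C}$ is a pair of classes $\underline{C}_{w\le0},\underline{C}_{w\ge0}$ of objects, closed under direct summands, with $\underline{C}_{w\le0}\subset\underline{C}_{w\le0}[1]$, $\underline{C}_{w\ge0}[1]\subset\underline{C}_{w\ge0}$, $\underline{C}(M,N)=0$ for all $M\in\underline{C}_{w\le0}$, $N\in\underline{C}_{w\ge0}[1]$, and such that every $M$ fits into a distinguished triangle $LM\to M\to RM\to LM[1]$ with $LM\in\underline{C}_{w\le0}$, $RM\in\underline{C}_{w\ge0}[1]$. Then $(\underline{C},w)$ is called a weighted category. $\underline{C}_{w\le i}=\underline{C}_{w\le0}[i]$, $\underline{C}_{w\ge i}=\underline{C}_{w\ge0}[i]$, $\underline{C}_{[0,1]}=\underline{C}_{w\ge0}\cap\underline{C}_{w\le1}$. The heart $\underline{Hw}$ is the full subcategory of $\underline{C}$ with object class $\underline{C}_{w\le0}\cap\underline{C}_{w\ge0}$. $\mathscr{K}(\underline{Hw})$ is the homotopy category of complexes over the additive category $\underline{Hw}$; a morphism $f:A\to B$ of $\underline{Hw}$ is viewed as a two-term complex (with $A$ and $B$ placed in two fixed adjacent degrees). $[U]$ denotes the isomorphism class of $U$. *)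

(* Defs.v *)
(* Hom-sets are abelian groups in the sense of MathComp ([zmodType]), so
   categories are preadditive and morphisms are compared by Leibniz equality.
   Composition is written in the usual order: [g ∘ f] is "f, then g". *)
From mathcomp Require Import all_boot all_order all_algebra.

Set Implicit Arguments.
Unset Strict Implicit.
Unset Printing Implicit Defensive.

Import GRing.Theory.
Local Open Scope ring_scope.

Record category := Category {
  ob :> Type;
  mor : ob -> ob -> zmodType;
  idm : forall X, mor X X;
  mcomp : forall X Y Z, mor Y Z -> mor X Y -> mor X Z;
  compA : forall W X Y Z (h : mor Y Z) (g : mor X Y) (f : mor W X),
    mcomp h (mcomp g f) = mcomp (mcomp h g) f;
  comp1m : forall X Y (f : mor X Y), mcomp (idm Y) f = f;
  compm1 : forall X Y (f : mor X Y), mcomp f (idm X) = f;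
  compDl : forall X Y Z (g g' : mor Y Z) (f : mor X Y),
    mcomp (g + g') f = mcomp g f + mcomp g' f;
  compDr : forall X Y Z (g : mor Y Z) (f f' : mor X Y),
    mcomp g (f + f') = mcomp g f + mcomp g f'
}.

Arguments mor {c} _ _.
Arguments idm {c} X.
Arguments mcomp {c X Y Z} _ _.

Notation "g ∘ f" := (mcomp g f) (at level 40, left associativity).

Section CategoryNotions.
Variable C : category.

Definition is_iso (X Y : C) (f : mor X Y) : Prop :=
  exists g : mor Y X, g ∘ f = idm X /\ f ∘ g = idm Y.

Definition isomorphic (X Y : C) : Prop := exists f : mor X Y, is_iso f.

Definition is_zero (Z : C) : Prop :=
  forall X : C, (forall f : mor Z X, f = 0) /\ (forall f : mor X Z, f = 0).

Definition is_biproduct (X Y S : C) (i1 : mor X S) (i2 : mor Y S)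
    (p1 : mor S X) (p2 : mor S Y) : Prop :=
  [/\ p1 ∘ i1 = idm X, p2 ∘ i2 = idm Y, p1 ∘ i2 = 0, p2 ∘ i1 = 0 &
      i1 ∘ p1 + i2 ∘ p2 = idm S].

Definition direct_summand (X M : C) : Prop :=
  exists (Y : C) (i1 : mor X M) (i2 : mor Y M) (p1 : mor M X) (p2 : mor M Y),
    is_biproduct i1 i2 p1 p2.

(* An isomorphism class is encoded as the predicate [isomorphic U] of its
   members. *)
Definition iso_classes : Type :=
  {P : C -> Prop | exists U : C, P = isomorphic U}.

Definition iso_class (U : C) : iso_classes :=
  exist _ (isomorphic U) (ex_intro _ U erefl).

End CategoryNotions.

Record functor (C D : category) := Functor {
  fob :> C -> D;
  fmor : forall X Y : C, mor X Y -> mor (fob X) (fob Y);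
  fmor_id : forall X : C, fmor (idm X) = idm (fob X);
  fmor_comp : forall (X Y Z : C) (g : mor Y Z) (f : mor X Y),
    fmor (g ∘ f) = fmor g ∘ fmor f
}.

Arguments fmor {C D} _ {X Y} _.

Definition additive_functor (C D : category) (F : functor C D) : Prop :=
  forall (X Y : C) (f g : mor X Y), fmor F (f + g) = fmor F f + fmor F g.

Definition functor_id (C : category) : functor C C :=
  @Functor C C id (fun _ _ f => f) (fun _ => erefl)
    (fun _ _ _ _ _ => erefl).

Definition functor_comp (C D E : category) (G : functor D E) (F : functor C D) :
  functor C E.
Proof.
refine (@Functor C E (fun X => G (F X)) (fun _ _ f => fmor G (fmor F f)) _ _).
- by move=> X; rewrite !fmor_id.
- by move=> X Y Z g f; rewrite !fmor_comp.
Defined.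

Definition nat_isomorphic (C D : category) (F G : functor C D) : Prop :=
  exists t : forall X : C, mor (F X) (G X),
    (forall X, is_iso (t X)) /\
    (forall (X Y : C) (f : mor X Y), t Y ∘ fmor F f = fmor G f ∘ t X).

Definition is_equivalence (C D : category) (F : functor C D) : Prop :=
  exists G : functor D C,
    nat_isomorphic (functor_comp G F) (functor_id C) /\
    nat_isomorphic (functor_comp F G) (functor_id D).

Definition full_subcategory (C : category) (P : C -> Prop) : category.
Proof.
refine (@Category {X : C | P X} (fun X Y => mor (sval X) (sval Y))
  (fun X => idm (sval X)) (fun X Y Z g f => g ∘ f) _ _ _ _ _).
- by move=> *; apply: compA.
- by move=> *; apply: comp1m.
- by move=> *; apply: compm1.
- by move=> *; apply: compDl.
- by move=> *; apply: compDr.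
Defined.

(* Cohomological indexing by [int]. *)
Record complex (B : category) := Complex {
  cob :> int -> B;
  cdiff : forall i : int, mor (cob i) (cob (i + 1));
  cdiff2 : forall i : int, cdiff (i + 1) ∘ cdiff i = 0
}.

Record chain_map (B : category) (X Y : complex B) := ChainMap {
  cmap :> forall i : int, mor (X i) (Y i);
  cmapP : forall i : int, cdiff Y i ∘ cmap i = cmap (i + 1) ∘ cdiff X i
}.

Definition chain_id (B : category) (X : complex B) : chain_map X X.
Proof.
refine (@ChainMap B X X (fun i => idm (X i)) _).
by move=> i; rewrite comp1m compm1.
Defined.

Definition chain_comp (B : category) (X Y Z : complex B)
  (g : chain_map Y Z) (f : chain_map X Y) : chain_map X Z.
Proof.
refine (@ChainMap B X Z (fun i => g i ∘ f i) _).
by move=> i; rewrite compA cmapP -!compA cmapP.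
Defined.

(* The homotopy is [s i : X^(i+1) -> Y^i]; the equation is stated in degree
   [i + 1], which ranges over all of [int]. *)
Definition homotopic (B : category) (X Y : complex B) (f g : chain_map X Y) :
    Prop :=
  exists s : forall i : int, mor (X (i + 1)) (Y i),
    forall i : int,
      f (i + 1) - g (i + 1) = cdiff Y i ∘ s i + s (i + 1) ∘ cdiff X (i + 1).

(* Isomorphism in the homotopy category of complexes. *)
Definition homotopy_equivalent (B : category) (X Y : complex B) : Prop :=
  exists (f : chain_map X Y) (g : chain_map Y X),
    homotopic (chain_comp g f) (chain_id X) /\
    homotopic (chain_comp f g) (chain_id Y).

Section TwoTerm.
Variables (B : category) (Z X Y : B) (f : mor X Y).

Definition two_term_ob (i : int) : B :=
  match i with Posz 0 => X | Posz 1 => Y | _ => Z end.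

Definition two_term_diff (i : int) : mor (two_term_ob i) (two_term_ob (i + 1)) :=
  match i return mor (two_term_ob i) (two_term_ob (i + 1)) with
  | Posz 0 => f
  | _ => 0
  end.

Lemma comp0m (U V W : B) (g : mor U V) : (0 : mor V W) ∘ g = 0.
Proof. by apply: (addIr (0 ∘ g)); rewrite -compDl !add0r. Qed.

Lemma compm0 (U V W : B) (g : mor V W) : g ∘ (0 : mor U V) = 0.
Proof. by apply: (addIr (g ∘ 0)); rewrite -compDr !add0r. Qed.

Lemma two_term_diff2 (i : int) : two_term_diff (i + 1) ∘ two_term_diff i = 0.
Proof. by case: i => [[|n]|n]; rewrite ?comp0m ?compm0. Qed.

(* ... -> Z -> X -f-> Y -> Z -> ... with X in degree 0; meant for Z a zero
   object. *)
Definition two_term : complex B := Complex two_term_diff2.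

End TwoTerm.

(* The shift is an additive autoequivalence, not necessarily strictly
   invertible. *)
Record triangulated := Triangulated {
  tcat :> category;
  tzero : tcat;
  tzeroP : is_zero tzero;
  tbiproduct : forall X Y : tcat,
    exists (S : tcat) (i1 : mor X S) (i2 : mor Y S)
           (p1 : mor S X) (p2 : mor S Y), is_biproduct i1 i2 p1 p2;
  shift : functor tcat tcat;
  shift_additive : additive_functor shift;
  shift_equivalence : is_equivalence shift;
  dist : forall X Y Z : tcat,
    mor X Y -> mor Y Z -> mor Z (shift X) -> Prop;
  (* TR1 *)
  dist_id : forall X : tcat, dist (idm X) (0 : mor X tzero) 0;
  dist_cone : forall (X Y : tcat) (f : mor X Y),
    exists (Z : tcat) (g : mor Y Z) (h : mor Z (shift X)), dist f g h;
  dist_iso : forall (X Y Z X' Y' Z' : tcat)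
    (f : mor X Y) (g : mor Y Z) (h : mor Z (shift X))
    (f' : mor X' Y') (g' : mor Y' Z') (h' : mor Z' (shift X'))
    (a : mor X X') (b : mor Y Y') (c : mor Z Z'),
    dist f g h -> is_iso a -> is_iso b -> is_iso c ->
    b ∘ f = f' ∘ a -> c ∘ g = g' ∘ b -> fmor shift a ∘ h = h' ∘ c ->
    dist f' g' h';
  (* TR2 *)
  dist_rotate : forall (X Y Z : tcat)
    (f : mor X Y) (g : mor Y Z) (h : mor Z (shift X)),
    dist f g h <-> dist g h (- fmor shift f);
  (* TR3 *)
  dist_complete : forall (X Y Z X' Y' Z' : tcat)
    (f : mor X Y) (g : mor Y Z) (h : mor Z (shift X))
    (f' : mor X' Y') (g' : mor Y' Z') (h' : mor Z' (shift X'))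
    (a : mor X X') (b : mor Y Y'),
    dist f g h -> dist f' g' h' -> b ∘ f = f' ∘ a ->
    exists c : mor Z Z', c ∘ g = g' ∘ b /\ fmor shift a ∘ h = h' ∘ c;
  (* TR4, the octahedral axiom *)
  dist_octahedral : forall (X Y Z X' Y' Z' : tcat)
    (f : mor X Y) (i : mor Y Z') (i' : mor Z' (shift X))
    (g : mor Y Z) (j : mor Z X') (j' : mor X' (shift Y))
    (k : mor Z Y') (k' : mor Y' (shift X)),
    dist f i i' -> dist g j j' -> dist (g ∘ f) k k' ->
    exists (u : mor Z' Y') (v : mor Y' X'),
      [/\ dist u v (fmor shift i ∘ j'),
          u ∘ i = k ∘ g, k' ∘ u = i', v ∘ k = j &
          j' ∘ v = fmor shift f ∘ k']
}.

Definition is_cone (C : triangulated) (X Y : C) (f : mor X Y) (U : C) : Prop :=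
  exists (g : mor Y U) (h : mor U (shift C X)), dist f g h.

(* The class P[1], closed under isomorphisms since the shift is only an
   equivalence. *)
Definition shifted (C : triangulated) (P : C -> Prop) (M : C) : Prop :=
  exists N : C, P N /\ isomorphic M (shift C N).

Record weight_structure (C : triangulated) := WeightStructure {
  w_le0 : C -> Prop;
  w_ge0 : C -> Prop;
  w_le0_summand : forall X M : C, direct_summand X M -> w_le0 M -> w_le0 X;
  w_ge0_summand : forall X M : C, direct_summand X M -> w_ge0 M -> w_ge0 X;
  w_le0_shift : forall M : C, w_le0 M -> shifted w_le0 M;
  w_ge0_shift : forall M : C, shifted w_ge0 M -> w_ge0 M;
  w_orthogonal : forall M N : C, w_le0 M -> shifted w_ge0 N ->
    forall f : mor M N, f = 0;
  w_decomposition : forall M : C,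
    exists (LM RM : C) (a : mor LM M) (b : mor M RM) (c : mor RM (shift C LM)),
      [/\ w_le0 LM, shifted w_ge0 RM & dist a b c]
}.

Definition w_le1 (C : triangulated) (w : weight_structure C) : C -> Prop :=
  shifted (w_le0 w).

Definition w_01 (C : triangulated) (w : weight_structure C) (M : C) : Prop :=
  w_ge0 w M /\ w_le1 w M.

Definition C01 (C : triangulated) (w : weight_structure C) : category :=
  full_subcategory (w_01 w).

Definition heart (C : triangulated) (w : weight_structure C) : category :=
  full_subcategory (fun M : C => w_le0 w M /\ w_ge0 w M).

Section HeartZero.
Variables (C : triangulated) (w : weight_structure C).

Lemma zero_direct_summand (M : C) : direct_summand (tzero C) M.
Proof.
exists M, 0, (idm M), 0, (idm M); have [z0 z0'] := tzeroP (tzero C).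
split; rewrite ?comp0m ?compm0 ?comp1m ?add0r //.
Qed.

Lemma heart_zero_proof : w_le0 w (tzero C) /\ w_ge0 w (tzero C).
Proof.
have [LM [RM [_ [_ [_ [leL [N [geN _]] _]]]]]] := w_decomposition w (tzero C).
by split; [apply: w_le0_summand leL | apply: w_ge0_summand geN];
  apply: zero_direct_summand.
Qed.

Definition heart_zero : heart w := exist _ (tzero C) heart_zero_proof.

Lemma heart_zeroP : is_zero heart_zero.
Proof. by move=> X; apply: (tzeroP (sval X)). Qed.

Definition heart_complex (A B : heart w) (f : mor A B) : complex (heart w) :=
  two_term heart_zero f.

Definition heart_cone (A B : heart w) (f : mor A B) (U : C) : Prop :=
  @is_cone C (sval A) (sval B) f U.

End HeartZero.

(* Main.v *)
(** Orthogonality and the long exact Hom sequences identify the objects of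
    [C_[0,1]] with the cones of heart morphisms: the weight decomposition
    [B -> U -> A[1]] of such an object has both [A] and [B] in the heart.
    An isomorphism of cones lifts to maps of two-term complexes, because
    [C(B, A'[1]) = 0]; the lifts are inverse to each other up to "weak"
    homotopies [(t ∘ f, f ∘ s)] with possibly [s <> t], and a nilpotency
    argument upgrades this to a homotopy equivalence. Conversely, a homotopy
    equivalence induces maps of cones whose composites are unipotent. The second
    part follows, since an additive equivalence preserves and reflects homotopy
    equivalence of two-term complexes. *)
From mathcomp Require Import all_boot all_order all_algebra.
From mathcomp Require Import boolp.
Require Import Defs.

Set Implicit Arguments.
Unset Strict Implicit.
Unset Printing Implicit Defensive.

Import GRing.Theory.
Local Open Scope ring_scope.

(** * Calculus in preadditive categories *)

Section Preadditive.
Variable B : category.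
Implicit Types X Y Z : B.

Lemma compNl X Y Z (g : mor Y Z) (f : mor X Y) : (- g) ∘ f = - (g ∘ f).
Proof. by apply: (addrI (g ∘ f)); rewrite -compDl !subrr comp0m. Qed.

Lemma compNr X Y Z (g : mor Y Z) (f : mor X Y) : g ∘ (- f) = - (g ∘ f).
Proof. by apply: (addrI (g ∘ f)); rewrite -compDr !subrr compm0. Qed.

Lemma compBl X Y Z (g g' : mor Y Z) (f : mor X Y) :
  (g - g') ∘ f = g ∘ f - g' ∘ f.
Proof. by rewrite compDl compNl. Qed.

Lemma compBr X Y Z (g : mor Y Z) (f f' : mor X Y) :
  g ∘ (f - f') = g ∘ f - g ∘ f'.
Proof. by rewrite compDr compNr. Qed.

Lemma isomorphic_refl X : isomorphic X X.
Proof. by exists (idm X), (idm X); rewrite comp1m. Qed.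

Lemma isomorphic_sym X Y : isomorphic X Y -> isomorphic Y X.
Proof. by move=> [f [g [gf fg]]]; exists g, f. Qed.

Lemma isomorphic_trans X Y Z :
  isomorphic X Y -> isomorphic Y Z -> isomorphic X Z.
Proof.
move=> [f [f' [f'f ff']]] [g [g' [g'g gg']]]; exists (g ∘ f), (f' ∘ g'); split.
- by rewrite -compA (compA g') g'g comp1m.
- by rewrite -compA (compA f) ff' comp1m.
Qed.

Lemma is_iso_left_right X Y (f : mor X Y) (l r : mor Y X) :
  l ∘ f = idm X -> f ∘ r = idm Y -> is_iso f.
Proof.
move=> lf fr; exists l; split=> //.
by rewrite -[l]compm1 -fr (compA l) lf comp1m.
Qed.

Lemma idm0_is_zero X : idm X = 0 -> is_zero X.
Proof.
by move=> X0 Y; split=> f; [rewrite -[f]compm1 X0 compm0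
                          | rewrite -[f]comp1m X0 comp0m].
Qed.

Lemma unipotent_inverse X (c d : mor X X) :
  d = idm X + c -> c ∘ c = 0 ->
  (idm X - c) ∘ d = idm X /\ d ∘ (idm X - c) = idm X.
Proof.
move=> -> cc; rewrite !(compBl, compBr, compDl, compDr, comp1m, compm1) cc.
by rewrite addr0 addrK.
Qed.

End Preadditive.

(** * Additive functors and equivalences of categories *)

Section Functors.
Variables (C D : category) (F : functor C D).

Section Additive.
Hypothesis Fadd : additive_functor F.

Lemma fmor0 (X Y : C) : fmor F (0 : mor X Y) = 0.
Proof. by apply: (addrI (fmor F 0)); rewrite -Fadd !addr0. Qed.

Lemma fmorN (X Y : C) (f : mor X Y) : fmor F (- f) = - fmor F f.
Proof. by apply: (addrI (fmor F f)); rewrite -Fadd !subrr fmor0. Qed.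

Lemma fmorB (X Y : C) (f g : mor X Y) : fmor F (f - g) = fmor F f - fmor F g.
Proof. by rewrite Fadd fmorN. Qed.

End Additive.

(** Naturality recovers [f] from [fmor G (fmor F f)]. Asking for this single isomorphism lets the
    lemma apply to a quasi-inverse of an equivalence as well. *)
Lemma nat_isomorphic_id_faithful (G : functor D C) (X Y : C) (f g : mor X Y) :
  nat_isomorphic (functor_comp G F) (functor_id C) ->
  fmor F f = fmor F g -> f = g.
Proof.
move=> [t [tiso tnat]] Ffg.
have [u [_ tu]] := tiso X.
rewrite -[f]compm1 -[g]compm1 -tu !compA.
by have /= <- := tnat _ _ f; have /= <- := tnat _ _ g; rewrite Ffg.
Qed.

End Functors.

Section Equivalence.
Variables (C D : category) (F : functor C D).
Hypothesis Feq : is_equivalence F.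

Lemma equivalence_faithful (X Y : C) (f g : mor X Y) :
  fmor F f = fmor F g -> f = g.
Proof. by have [G [GF _]] := Feq; apply: nat_isomorphic_id_faithful GF. Qed.

Lemma equivalence_full (X Y : C) (g : mor (F X) (F Y)) :
  exists f : mor X Y, fmor F f = g.
Proof.
have [G [GF FG]] := Feq.
have [t [tiso tnat]] := GF.
have [u [ut tu]] := tiso X.
(* By naturality of [t], the image of this morphism under [G ∘ F] is [fmor G g]; since [G] is
   faithful too, [F] sends it to [g]. *)
exists (t Y ∘ fmor G g ∘ u).
apply: (nat_isomorphic_id_faithful FG).
have [v [vt tv]] := tiso Y.
have /= e := tnat _ _ (t Y ∘ fmor G g ∘ u).
rewrite -[LHS]comp1m -[in LHS]vt -[LHS]compA e.
by rewrite -!compA ut compm1 (compA v) vt comp1m.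
Qed.

Lemma equivalence_ess_surj (Y : D) : exists X : C, isomorphic Y (F X).
Proof.
have [G [_ [t [tiso _]]]] := Feq.
exists (G Y); have [u [ut tu]] := tiso Y; exists u, (t Y); exact: conj tu ut.
Qed.

Lemma equivalence_reflects_iso (X Y : C) :
  isomorphic (F X) (F Y) -> isomorphic X Y.
Proof.
move=> [f0 [g0]]; have [f <-] := equivalence_full f0.
have [g <-] := equivalence_full g0.
rewrite -!fmor_comp -!fmor_id => -[gf fg].
by exists f, g; split; apply: equivalence_faithful.
Qed.

End Equivalence.

(** * Two-term complexes as arrows, their chain maps as commutative squares *)

Section ArrowHomotopy.
Variable B : category.

Definition arrow_map (X Y X' Y' : B) (f : mor X Y) (f' : mor X' Y')
    (m : mor X X' * mor Y Y') : Prop :=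
  f' ∘ m.1 = m.2 ∘ f.

Definition arrow_id (X Y : B) : mor X X * mor Y Y := (idm X, idm Y).

Definition arrow_comp (X Y X' Y' X2 Y2 : B) (n : mor X' X2 * mor Y' Y2)
    (m : mor X X' * mor Y Y') : mor X X2 * mor Y Y2 :=
  (n.1 ∘ m.1, n.2 ∘ m.2).

(** Of a chain homotopy between two-term complexes, only the component [Y -> X'] can be nonzero. *)
Definition arrow_homotopic (X Y X' Y' : B) (f : mor X Y) (f' : mor X' Y')
    (m n : mor X X' * mor Y Y') : Prop :=
  exists s : mor Y X', m.1 - n.1 = s ∘ f /\ m.2 - n.2 = f' ∘ s.

Definition weakly_homotopic (X Y X' Y' : B) (f : mor X Y) (f' : mor X' Y')
    (m n : mor X X' * mor Y Y') : Prop :=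
  exists s t : mor Y X', m.1 - n.1 = t ∘ f /\ m.2 - n.2 = f' ∘ s.

Definition arrow_equivalent (X Y X' Y' : B) (f : mor X Y) (f' : mor X' Y') :
    Prop :=
  exists (m : mor X X' * mor Y Y') (n : mor X' X * mor Y' Y),
    [/\ arrow_map f f' m, arrow_map f' f n,
        arrow_homotopic f f (arrow_comp n m) (arrow_id X Y) &
        arrow_homotopic f' f' (arrow_comp m n) (arrow_id X' Y')].

Lemma arrow_map_comp (X Y X' Y' X2 Y2 : B) (f : mor X Y) (f' : mor X' Y')
    (f2 : mor X2 Y2) n m :
  arrow_map f' f2 n -> arrow_map f f' m -> arrow_map f f2 (arrow_comp n m).
Proof. by rewrite /arrow_map /= => en em; rewrite compA en -!compA em. Qed.

Lemma arrow_compA (X Y X' Y' X2 Y2 X3 Y3 : B) (k : mor X2 X3 * mor Y2 Y3)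
    (n : mor X' X2 * mor Y' Y2) (m : mor X X' * mor Y Y') :
  arrow_comp k (arrow_comp n m) = arrow_comp (arrow_comp k n) m.
Proof. by rewrite /arrow_comp /= !compA. Qed.

Lemma arrow_comp1m (X Y X' Y' : B) (m : mor X X' * mor Y Y') :
  arrow_comp (arrow_id X' Y') m = m.
Proof. by case: m => a b; rewrite /arrow_comp /= !comp1m. Qed.

Lemma arrow_compm1 (X Y X' Y' : B) (m : mor X X' * mor Y Y') :
  arrow_comp m (arrow_id X Y) = m.
Proof. by case: m => a b; rewrite /arrow_comp /= !compm1. Qed.

Lemma arrow_homotopic_sym (X Y X' Y' : B) (f : mor X Y) (f' : mor X' Y') m n :
  arrow_homotopic f f' m n -> arrow_homotopic f f' n m.
Proof.
by move=> [s [e1 e2]]; exists (- s); rewrite compNl compNr -e1 -e2 !opprB.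
Qed.

Lemma arrow_homotopic_trans (X Y X' Y' : B) (f : mor X Y) (f' : mor X' Y')
    m n k :
  arrow_homotopic f f' m n -> arrow_homotopic f f' n k ->
  arrow_homotopic f f' m k.
Proof.
move=> [s [e1 e2]] [t [e3 e4]]; exists (s + t).
by rewrite compDl compDr -e1 -e2 -e3 -e4 !addrA !subrK.
Qed.

Lemma arrow_homotopic_compl (X Y X' Y' X2 Y2 : B) (f : mor X Y)
    (f' : mor X' Y') (f2 : mor X2 Y2) k m n :
  arrow_map f' f2 k -> arrow_homotopic f f' m n ->
  arrow_homotopic f f2 (arrow_comp k m) (arrow_comp k n).
Proof.
move=> ek [s [e1 e2]]; exists (k.1 ∘ s) => /=.
by rewrite -!compBr e1 e2 !compA ek.
Qed.

Lemma arrow_homotopic_compr (X Y X' Y' X2 Y2 : B) (f : mor X Y)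
    (f' : mor X' Y') (f2 : mor X2 Y2) k m n :
  arrow_map f f' k -> arrow_homotopic f' f2 m n ->
  arrow_homotopic f f2 (arrow_comp m k) (arrow_comp n k).
Proof.
move=> ek [s [e1 e2]]; exists (s ∘ k.2) => /=.
by rewrite -!compBl e1 e2 -!compA ek.
Qed.

(** As for ordinary inverses, [l] is homotopic to [l ∘ m ∘ r], hence to [r]. *)
Lemma arrow_equivalent_left_right (X Y X' Y' : B) (f : mor X Y)
    (f' : mor X' Y') m l r :
  arrow_map f f' m -> arrow_map f' f l -> arrow_map f' f r ->
  arrow_homotopic f f (arrow_comp l m) (arrow_id X Y) ->
  arrow_homotopic f' f' (arrow_comp m r) (arrow_id X' Y') ->
  arrow_equivalent f f'.
Proof.
move=> em el er lm mr; exists m, l; split=> //.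
apply: arrow_homotopic_trans (mr).
apply: (arrow_homotopic_compl em).
rewrite -[l]arrow_compm1 -[X in arrow_homotopic _ _ _ X]arrow_comp1m.
apply: (@arrow_homotopic_trans _ _ _ _ _ _ _ (arrow_comp l (arrow_comp m r))).
  exact: (arrow_homotopic_compl el (arrow_homotopic_sym mr)).
by rewrite arrow_compA; apply: (arrow_homotopic_compr er lm).
Qed.

(* Modulo a null-homotopic map, [m - 1] is [((t - s) ∘ f, 0)], whose square
   vanishes because [f ∘ t ∘ f = f ∘ s ∘ f]; hence [m] is invertible up to
   homotopy. *)
Lemma weakly_homotopic_id_inverse (X Y : B) (f : mor X Y) m :
  arrow_map f f m -> weakly_homotopic f f m (arrow_id X Y) ->
  exists n, [/\ arrow_map f f n,
    arrow_homotopic f f (arrow_comp n m) (arrow_id X Y) &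
    arrow_homotopic f f (arrow_comp m n) (arrow_id X Y)].
Proof.
case: m => p q /= em [s [t /= [ep eq]]]; rewrite /arrow_map /= in em.
have {}ep : p = idm X + t ∘ f by rewrite -ep addrC subrK.
have {}eq : q = idm Y + f ∘ s by rewrite -eq addrC subrK.
pose r := t - s.
have frf : f ∘ r ∘ f = 0.
  have : f ∘ t ∘ f = f ∘ s ∘ f.
    rewrite -compA; apply: (addrI f); rewrite -{1}[f]compm1 -compDr -ep em.
    by rewrite eq compDl comp1m.
  by rewrite /r compBr compBl => ->; rewrite subrr.
have {}ep : p = idm X + s ∘ f + r ∘ f.
  by rewrite ep /r compBl -addrA [_ + (_ - _)]addrC subrK.
move: r frf ep => r frf ep.
(* Up to the homotopy [s], the map is [(idm X + r ∘ f, idm Y)], whose strict inverse is this pair.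
   Composing [s] with the pair on the left gives the first homotopy below; composing on the right
   leaves [s]. *)
exists (idm X - r ∘ f, idm Y); rewrite /arrow_map /arrow_homotopic /=; split.
- by rewrite compBr compm1 comp1m compA frf subr0.
- exists (s - r ∘ f ∘ s); split.
    have rfp : r ∘ f ∘ p = r ∘ f + r ∘ f ∘ s ∘ f.
      rewrite ep !compDr compm1 !compA -(compA r f r) -(compA r (f ∘ r)) frf.
      by rewrite compm0 addr0.
    rewrite !compBl comp1m rfp ep opprD addrA addrK addrAC.
    by rewrite [idm X + _]addrC addrK.
  by rewrite eq comp1m compBr !compA frf comp0m subr0 addrC addKr.
- exists s; split; last by rewrite eq compm1 addrC addKr.
  rewrite ep !(compBr, compDl, comp1m, compm1) -!compA [f ∘ (r ∘ f)]compA frf.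
  by rewrite !compm0 !addr0 addrK addrC addKr.
Qed.

(** Both composites are invertible up to homotopy, which gives [m] a left and a right homotopy
    inverse. *)
Lemma arrow_equivalent_weak (X Y X' Y' : B) (f : mor X Y) (f' : mor X' Y')
    m n :
  arrow_map f f' m -> arrow_map f' f n ->
  weakly_homotopic f f (arrow_comp n m) (arrow_id X Y) ->
  weakly_homotopic f' f' (arrow_comp m n) (arrow_id X' Y') ->
  arrow_equivalent f f'.
Proof.
move=> em en nm mn.
have [k [ek knm _]] := weakly_homotopic_id_inverse (arrow_map_comp en em) nm.
have [k' [ek' _ mnk]] := weakly_homotopic_id_inverse (arrow_map_comp em en) mn.
apply: (arrow_equivalent_left_right em (arrow_map_comp ek en)
         (arrow_map_comp en ek')).
- by rewrite -arrow_compA.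
- by rewrite arrow_compA.
Qed.

Lemma arrow_equivalent_iso (X Y X' Y' : B) (f : mor X Y) (f' : mor X' Y')
    (a : mor X X') (b : mor Y Y') :
  is_iso a -> is_iso b -> f' ∘ a = b ∘ f -> arrow_equivalent f f'.
Proof.
move=> [a' [a'a aa']] [b' [b'b bb']] e; exists (a, b), (a', b'); split=> //.
- by rewrite /arrow_map /= -[f]comp1m -b'b -!compA [b ∘ _]compA -e -compA aa'
    compm1.
- by exists 0; rewrite /= a'a b'b !subrr comp0m compm0.
- by exists 0; rewrite /= aa' bb' !subrr comp0m compm0.
Qed.

(** * Comparison with homotopy equivalence of complexes *)

Section TwoTermComplexes.
Variables (Z : B).
Hypothesis Z0 : is_zero Z.
Variables (X Y X' Y' : B) (f : mor X Y) (f' : mor X' Y').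

Definition two_term_cmap (m : mor X X' * mor Y Y') (i : int) :
    mor (two_term Z f i) (two_term Z f' i) :=
  match i return mor (two_term_ob Z X Y i) (two_term_ob Z X' Y' i) with
  | Posz 0 => m.1
  | Posz 1 => m.2
  | _ => 0
  end.

Lemma two_term_cmapP m : arrow_map f f' m -> forall i : int,
  cdiff (two_term Z f') i ∘ two_term_cmap m i =
  two_term_cmap m (i + 1) ∘ cdiff (two_term Z f) i.
Proof. by move=> em [[|[|n]]|[|n]] //=; rewrite !(comp0m, compm0). Qed.

Definition two_term_map m (em : arrow_map f f' m) :
    chain_map (two_term Z f) (two_term Z f') :=
  ChainMap (two_term_cmapP em).

Definition two_term_homotopy (s : mor Y X') (i : int) :
    mor (two_term Z f (i + 1)) (two_term Z f' i) :=
  match i return mor (two_term_ob Z X Y (i + 1)) (two_term_ob Z X' Y' i) with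
  | Posz 0 => s
  | _ => 0
  end.

(** Index [i] of [homotopic] concerns degree [i + 1], so degrees 0 and 1 are found at [Negz 0] (that
    is, -1) and [Posz 0]. In every other degree both sides of the equation start or end at a zero
    object. *)
Lemma two_term_homotopic (m n : chain_map (two_term Z f) (two_term Z f')) :
  homotopic m n <->
  arrow_homotopic f f' (m (Posz 0), m (Posz 1)) (n (Posz 0), n (Posz 1)).
Proof.
split=> [[s es]|[s [/= e1 e2]]].
  exists (s (Posz 0)); split.
    by have := es (Negz 0); rewrite /= comp0m add0r.
  by have := es (Posz 0); rewrite /= compm0 addr0.
exists (two_term_homotopy s) => -[[|[|k]]|[|k]].
- by rewrite /= compm0 addr0.
- by rewrite [LHS](Z0 _).2 [RHS](Z0 _).2.
- by rewrite [LHS](Z0 _).2 [RHS](Z0 _).2.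
- by rewrite /= comp0m add0r.
- by rewrite [LHS](Z0 _).1 [RHS](Z0 _).1.
Qed.

End TwoTermComplexes.

Lemma two_term_equivalence (Z X Y X' Y' : B) (f : mor X Y) (f' : mor X' Y') :
  is_zero Z ->
  homotopy_equivalent (two_term Z f) (two_term Z f') <-> arrow_equivalent f f'.
Proof.
move=> Z0; split=> [[m [n [nm mn]]]|[m [n [em en nm mn]]]].
  exists (m (Posz 0), m (Posz 1)), (n (Posz 0), n (Posz 1)); split.
  - exact: (cmapP m (Posz 0)).
  - exact: (cmapP n (Posz 0)).
  - exact: (two_term_homotopic Z0 _ _).1 nm.
  - exact: (two_term_homotopic Z0 _ _).1 mn.
exists (two_term_map Z em), (two_term_map Z en).
by split; apply/(two_term_homotopic Z0).
Qed.

End ArrowHomotopy.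

(** A homotopy equivalence consists of morphisms subject to additive equations: fullness lifts the
    morphisms, faithfulness reflects the equations. *)
Lemma fmor_arrow_equivalent (B D : category) (F : functor B D) (X Y X' Y' : B)
    (f : mor X Y) (f' : mor X' Y') :
  additive_functor F -> is_equivalence F ->
  arrow_equivalent (fmor F f) (fmor F f') <-> arrow_equivalent f f'.
Proof.
move=> Fadd Feq; split.
  move=> [[a0 b0] [[a0' b0'] [em en [s0 [e1 e2]] [t0 [e3 e4]]]]].
  have [a ea] := equivalence_full Feq a0.
  have [b eb] := equivalence_full Feq b0.
  have [a' ea'] := equivalence_full Feq a0'.
  have [b' eb'] := equivalence_full Feq b0'.
  have [s es] := equivalence_full Feq s0.
  have [t et] := equivalence_full Feq t0.
  subst; rewrite /arrow_map /= -!fmor_comp -?fmor_id -?fmorB //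
    in em en e1 e2 e3 e4.
  exists (a, b), (a', b').
  by split; [| |exists s; split|exists t; split];
    apply: equivalence_faithful Feq _ _ _ _ _.
move=> [[a b] [[a' b'] [em en [s [e1 e2]] [t [e3 e4]]]]].
rewrite /arrow_map /= in em en e1 e2 e3 e4.
exists (fmor F a, fmor F b), (fmor F a', fmor F b').
rewrite /arrow_map; split=> /=; rewrite -?fmor_comp ?em ?en //.
- exists (fmor F s); rewrite /= -!fmor_comp -!fmor_id -!fmorB //.
  by rewrite e1 e2.
- exists (fmor F t); rewrite /= -!fmor_comp -!fmor_id -!fmorB //.
  by rewrite e3 e4.
Qed.

(** * Exact Hom sequences, retracts and maps between cones *)

Section Triangulated.
Variable C : triangulated.
Implicit Types X Y Z W L M N U V : C.

Local Notation sh := (shift C).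

Definition orth X Y : Prop := forall f : mor X Y, f = 0.

Lemma shift_full X Y (g : mor (sh X) (sh Y)) :
  exists f : mor X Y, fmor sh f = g.
Proof. exact: equivalence_full (@shift_equivalence C) _ _ _. Qed.

Lemma shift_faithful X Y (f g : mor X Y) : fmor sh f = fmor sh g -> f = g.
Proof. exact: equivalence_faithful (@shift_equivalence C) _ _ _ _. Qed.

Lemma orth_shift X Y : orth (sh X) (sh Y) <-> orth X Y.
Proof.
have add := @shift_additive C.
split=> o f; last by have [f0 <-] := shift_full f; rewrite (o f0) fmor0.
by apply: shift_faithful; rewrite fmor0.
Qed.

Lemma orth_isol X X' Y : isomorphic X X' -> orth X' Y -> orth X Y.
Proof.
move=> [f [g [gf _]]] o h; rewrite -[h]compm1 -gf compA.
by rewrite (o (h ∘ g)) comp0m.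
Qed.

Lemma orth_isor X Y Y' : isomorphic Y Y' -> orth X Y' -> orth X Y.
Proof.
move=> [f [g [gf _]]] o h; rewrite -[h]comp1m -gf -compA.
by rewrite (o (f ∘ h)) compm0.
Qed.

Lemma rotate X Y Z (f : mor X Y) (g : mor Y Z) h :
  dist f g h -> dist g h (- fmor sh f).
Proof. by case: (dist_rotate f g h). Qed.

(** A map from the triangle [X -> X -> 0] factors [g ∘ f] through the zero object. *)
Lemma dist_comp0 X Y Z (f : mor X Y) (g : mor Y Z) h :
  dist f g h -> g ∘ f = 0.
Proof.
move=> d; have e : f ∘ idm X = f ∘ idm X by [].
by have [c [<- _]] := dist_complete (dist_id X) d e; rewrite compm0.
Qed.

(** Exactness of [mor W _] at [Y]. TR3 only supplies a third component, so both triangles are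
    rotated first; the lift then appears as a map [sh W -> sh X], and the shift is full and
    faithful. *)
Lemma dist_lift X Y Z W (f : mor X Y) (g : mor Y Z) h (u : mor W Y) :
  dist f g h -> g ∘ u = 0 -> exists v : mor W X, u = f ∘ v.
Proof.
move=> d gu0.
have e : (0 : mor (tzero C) Z) ∘ (0 : mor W (tzero C)) = g ∘ u.
  by rewrite gu0 comp0m.
have [c [_]] := dist_complete (rotate (dist_id W))
  (rotate d) e.
have [v <-] := shift_full c.
rewrite fmor_id compNr compm1 compNl => /oppr_inj.
by rewrite -fmor_comp => /shift_faithful ->; exists v.
Qed.

Lemma shift_tzero : is_zero (sh (tzero C)).
Proof.
apply: idm0_is_zero; rewrite -fmor_id [idm _](tzeroP (tzero C)).1 fmor0 //.
exact: shift_additive.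
Qed.

(** Its rotation is isomorphic to [dist_id W], because [sh (tzero C)] is again a zero object. *)
Lemma dist_0id W : dist (0 : mor (tzero C) W) (idm W) 0.
Proof.
have z := @tzeroP C; have z' := shift_tzero.
apply/dist_rotate; apply: (dist_iso (dist_id W) (a := idm W) (b := idm W)
  (c := (0 : mor (tzero C) (sh (tzero C))))).
- by exists (idm W); rewrite comp1m.
- by exists (idm W); rewrite comp1m.
- by exists 0; rewrite [RHS](z _).1 [idm (sh _)](z' _).1 comp0m compm0.
- by [].
- by rewrite compm0 comp0m.
- by rewrite [LHS](z _).1 [RHS](z _).1.
Qed.

(** Exactness of [mor _ W] at [Y], by mapping the triangle to [0 -> W -> W]. *)
Lemma dist_extend X Y Z W (f : mor X Y) (g : mor Y Z) h (u : mor Y W) :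
  dist f g h -> u ∘ f = 0 -> exists v : mor Z W, u = v ∘ g.
Proof.
move=> d uf0.
have e : u ∘ f = (0 : mor (tzero C) W) ∘ (0 : mor X (tzero C)).
  by rewrite uf0 comp0m.
have [v [ev _]] := dist_complete d (dist_0id W) e.
by exists v; rewrite ev comp1m.
Qed.

Lemma orth_extr L X Y Z (f : mor X Y) (g : mor Y Z) h :
  dist f g h -> orth L X -> orth L Z -> orth L Y.
Proof.
move=> d oX oZ u; have [v ->] := dist_lift d (oZ (g ∘ u)).
by rewrite (oX v) compm0.
Qed.

Lemma orth_extl X Y Z N (f : mor X Y) (g : mor Y Z) h :
  dist f g h -> orth X N -> orth Z N -> orth Y N.
Proof.
move=> d oX oZ u; have [v ->] := dist_extend d (oX (u ∘ f)).
by rewrite (oZ v) comp0m.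
Qed.

Definition retract X M : Prop :=
  exists (i : mor X M) (p : mor M X), p ∘ i = idm X.

(* The complement of a retract is the cone of its inclusion. *)
Lemma retract_direct_summand X M : retract X M -> direct_summand X M.
Proof.
move=> [i [p pi]]; have [Y [q [h d]]] := dist_cone i.
(* [fmor sh i ∘ h = 0], and [fmor sh i] is a split monomorphism. *)
have h0 : h = 0.
  rewrite -[h]comp1m -fmor_id -pi fmor_comp -compA.
  have := dist_comp0 (rotate (rotate d)).
  rewrite compNl => /eqP; rewrite oppr_eq0 => /eqP ->; exact: compm0.
have [s' es'] : exists s : mor Y M, idm Y = q ∘ s.
  by apply: (dist_lift (rotate d)); rewrite h0 comp0m.
have qi := dist_comp0 d.
(* Removing the component of [s'] along [i] makes [p ∘ s] vanish and keeps [q ∘ s = idm Y]. *)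
pose s := s' - i ∘ p ∘ s'.
have qs : q ∘ s = idm Y by rewrite /s compBr !compA qi !comp0m subr0.
have ps : p ∘ s = 0 by rewrite /s compBr !compA pi comp1m subrr.
exists Y, i, s, p, q; split=> //.
apply/eqP; rewrite eq_sym -subr_eq0; apply/eqP.
(* From [q ∘ e = 0], [e] factors through [i]; from [p ∘ e = 0], the factor is zero. *)
set e := idm M - _.
have qe : q ∘ e = 0.
  by rewrite /e compBr compDr !compA qi qs comp0m comp1m compm1 add0r subrr.
have pe : p ∘ e = 0.
  by rewrite /e compBr compDr !compA pi ps comp0m comp1m compm1 addr0 subrr.
have [v ev] := dist_lift d qe.
by move: pe; rewrite ev compA pi comp1m => ->; rewrite compm0.
Qed.

Lemma isomorphic_direct_summand X M : isomorphic X M -> direct_summand X M.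
Proof.
by move=> [f [g [gf _]]]; apply: retract_direct_summand; exists f, g.
Qed.

Lemma dist_shift X Y Z (f : mor X Y) (g : mor Y Z) h : dist f g h ->
  dist (- fmor sh f) (- fmor sh g) (- fmor sh h).
Proof. by move=> d; exact: rotate (rotate (rotate d)). Qed.

(** The obstruction to lifting [c ∘ g] along [g'] is [h' ∘ c ∘ g], which lies in [mor Y (sh X')] and
    so vanishes. TR3 on the rotated triangles then gives the shift of the other component. *)
Lemma cone_map_extends X Y Z X' Y' Z' (f : mor X Y) (g : mor Y Z) h
    (f' : mor X' Y') (g' : mor Y' Z') h' (c : mor Z Z') :
  dist f g h -> dist f' g' h' -> orth Y (sh X') ->
  exists m : mor X X' * mor Y Y', [/\ arrow_map f f' m, c ∘ g = g' ∘ m.2 &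
    fmor sh m.1 ∘ h = h' ∘ c].
Proof.
move=> d d' o.
have [b eb] := dist_lift (rotate d') (o (h' ∘ (c ∘ g))).
have [c' [ec']] := dist_complete (rotate d)
  (rotate d') eb.
have [a ea] := shift_full c'; rewrite -ea in ec' *.
rewrite compNl compNr -!fmor_comp => /oppr_inj /shift_faithful e.
by exists (a, b); split.
Qed.

(* The components of [m - 1] factor through [f] for unrelated reasons, so only
   a weak homotopy results. *)
Lemma cone_map_weakly_homotopic_id X Y Z (f : mor X Y) (g : mor Y Z) h
    (m : mor X X * mor Y Y) :
  dist f g h -> g ∘ m.2 = g -> fmor sh m.1 ∘ h = h ->
  weakly_homotopic f f m (arrow_id X Y).
Proof.
move=> d eg eh; have add := @shift_additive C.
have [s es] : exists s, m.2 - idm Y = f ∘ s.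
  by apply: (dist_lift d); rewrite compBr eg compm1 subrr.
have eh0 : fmor sh (m.1 - idm X) ∘ h = 0.
  by rewrite fmorB // compBl eh fmor_id comp1m subrr.
have [t' et] := dist_extend (rotate (rotate d))
  eh0.
have [t ett] := shift_full t'.
(* The sign cancels the one that rotation puts on [fmor sh f]. *)
exists s, (- t); split=> //.
apply: shift_faithful; rewrite et -ett compNl fmorN // compNr.
by rewrite -fmor_comp.
Qed.

Lemma cone_iso_arrow_equivalent X Y U X' Y' U' (f : mor X Y) (f' : mor X' Y') :
  orth Y (sh X) -> orth Y (sh X') -> orth Y' (sh X) -> orth Y' (sh X') ->
  is_cone f U -> is_cone f' U' ->
  isomorphic U U' <-> arrow_equivalent f f'.
Proof.
move=> o1 o2 o3 o4 [g [h d]] [g' [h' d']]; split.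
  move=> [c [c' [c'c cc']]].
  have [m [em em1 em2]] := cone_map_extends c d d' o2.
  have [n [en en1 en2]] := cone_map_extends c' d' d o3.
  (* Each composite of the lifts lies over the identity of a cone, so it is weakly homotopic to the
     identity. *)
  apply: (arrow_equivalent_weak em en).
  - apply: (cone_map_weakly_homotopic_id d) => /=.
      by rewrite compA -en1 -compA -em1 compA c'c comp1m.
    by rewrite fmor_comp -compA em2 compA en2 -compA c'c compm1.
  - apply: (cone_map_weakly_homotopic_id d') => /=.
      by rewrite compA -em1 -compA -en1 compA cc' comp1m.
    by rewrite fmor_comp -compA en2 compA em2 -compA cc' compm1.
(* If [n ∘ m] is homotopic to the identity, the maps [c], [c'] that they induce
   on cones satisfy [c' ∘ c = 1 + e] with [e ∘ g = 0] and [h ∘ e = 0], so that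
   [e] factors through [h] and [e ∘ e = 0]. *)
have add := @shift_additive C.
have unip P Q V (k : mor P Q) (i : mor Q V) j (p : mor P P * mor Q Q) r :
    dist k i j -> arrow_homotopic k k p (arrow_id P Q) ->
    r ∘ i = i ∘ p.2 -> fmor sh p.1 ∘ j = j ∘ r ->
    exists r', r' ∘ r = idm V /\ r ∘ r' = idm V.
  move=> dk [s [/= e1 e2]] er1 er2.
  pose e := r - idm V.
  have ei : e ∘ i = 0.
    rewrite compBl comp1m er1 -{2}[i]compm1 -compBr e2 compA.
    by rewrite (dist_comp0 dk) comp0m.
  have je : j ∘ e = 0.
    rewrite compBr compm1 -er2 -{2}[j]comp1m -fmor_id -compBl -fmorB // e1.
    have dr := rotate (rotate dk).
    have := dist_comp0 dr; rewrite compNl => /eqP; rewrite oppr_eq0 => /eqP kj.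
    by rewrite fmor_comp -compA kj compm0.
  have [v ev] := dist_extend (rotate dk) ei.
  exists (idm V - e); apply: unipotent_inverse.
    by rewrite /e addrC subrK.
  by rewrite {1}ev -compA je compm0.
move=> [m [n [em en nm mn]]].
have em' : m.2 ∘ f = f' ∘ m.1 by rewrite em.
have en' : n.2 ∘ f' = f ∘ n.1 by rewrite en.
have [c [ec1 ec2]] := dist_complete d d' em'.
have [c' [ec1' ec2']] := dist_complete d' d en'.
have [l [lcc _]] : exists l, l ∘ (c' ∘ c) = idm U /\ (c' ∘ c) ∘ l = idm U.
  apply: (unip _ _ _ _ _ _ _ _ d nm) => /=.
    by rewrite -compA ec1 compA ec1' compA.
  by rewrite fmor_comp -compA ec2 compA ec2' compA.
have [r [_ ccr]] : exists r, r ∘ (c ∘ c') = idm U' /\ (c ∘ c') ∘ r = idm U'.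
  apply: (unip _ _ _ _ _ _ _ _ d' mn) => /=.
    by rewrite -compA ec1' compA ec1 compA.
  by rewrite fmor_comp -compA ec2' compA ec2 compA.
(* Both [c' ∘ c] and [c ∘ c'] are invertible, which gives [c] a left and a right inverse. *)
exists c; apply: (@is_iso_left_right _ _ _ _ (l ∘ c') (c' ∘ r)).
  by rewrite -compA.
by rewrite compA.
Qed.

End Triangulated.

(** * Weight classes as orthogonals, and cones of heart morphisms *)

Section Weights.
Variables (C : triangulated) (w : weight_structure C).
Implicit Types L M N U : C.

Local Notation sh := (shift C).

Lemma shifted_shift (P : C -> Prop) N : P N -> shifted P (sh N).
Proof. by move=> PN; exists N; split=> //; apply: isomorphic_refl. Qed.

Lemma w_ge0_iso M N : isomorphic M N -> w_ge0 w N -> w_ge0 w M.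
Proof. by move=> /isomorphic_direct_summand; apply: w_ge0_summand. Qed.

(** If [M] is orthogonal to [w_le0], the first map of its weight decomposition vanishes, so [M] is a
    retract of [R]. *)
Lemma w_ge1_orth M :
  shifted (w_ge0 w) M <-> forall L, w_le0 w L -> orth L M.
Proof.
split=> [ge1M L leL|o]; first exact: w_orthogonal leL ge1M.
have [L [R [a [b [c [leL [N [geN eN]] d]]]]]] := w_decomposition w M.
have [r er] : exists r : mor R M, idm M = r ∘ b.
  by apply: (dist_extend d); rewrite comp1m (o L leL a).
(* Closure under summands is an axiom for [w_ge0], not for its shift: the retraction is carried to
   [sh M0] and [sh N], then unshifted. *)
have [M0 eM] := equivalence_ess_surj (@shift_equivalence C) M.
exists M0; split=> //; apply: w_ge0_summand geN.
apply: retract_direct_summand.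
have [u [v [vu _]]] := eN; have [x [y [_ xy]]] := eM.
have [i ei] := shift_full (u ∘ b ∘ y).
have [p ep] := shift_full (x ∘ r ∘ v).
exists i, p; apply: shift_faithful.
rewrite fmor_comp fmor_id ei ep -!compA (compA v) vu comp1m (compA r) -er.
by rewrite comp1m.
Qed.

Lemma w_ge0_orth M : w_ge0 w M <-> forall L, w_le0 w L -> orth L (sh M).
Proof.
split=> [geM|o]; first exact/w_ge1_orth/shifted_shift.
have [N [geN eN]] := (w_ge1_orth (sh M)).2 o.
by apply: w_ge0_iso geN; apply: equivalence_reflects_iso eN;
  apply: shift_equivalence.
Qed.

(** Dually, the second map of the weight decomposition vanishes and [M] is a retract of [L]. *)
Lemma w_le0_orth M : w_le0 w M <-> forall N, w_ge0 w N -> orth M (sh N).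
Proof.
split=> [leM N geN|o].
  by apply: w_orthogonal leM _; apply: shifted_shift.
have [L [R [a [b [c [leL [N [geN eN]] d]]]]]] := w_decomposition w M.
have [l el] : exists l : mor M L, idm M = a ∘ l.
  by apply: (dist_lift d); rewrite compm1 (orth_isor eN (o N geN) b).
by apply: w_le0_summand leL; apply: retract_direct_summand; exists l, a.
Qed.

Lemma w_le1_orth M :
  w_le1 w M <-> forall N, w_ge0 w N -> orth M (sh (sh N)).
Proof.
split=> [[L [leL eL]] N geN|o].
  by apply: (orth_isol eL); apply/orth_shift; exact: (w_le0_orth L).1 leL N geN.
have [L eL] := equivalence_ess_surj (@shift_equivalence C) M.
exists L; split=> //; apply/w_le0_orth => N geN; apply/orth_shift.
exact: orth_isol (isomorphic_sym eL) (o N geN).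
Qed.

Lemma heart_orth (A B : heart w) : orth (sval A) (sh (sval B)).
Proof.
exact: w_orthogonal (proj1 (svalP A)) (shifted_shift (proj2 (svalP B))).
Qed.

(** The cone is an extension of [sh A] by [B], both in [w_01], and classes defined by orthogonality
    are closed under extensions. *)
Lemma heart_cone_w_01 (A B : heart w) (f : mor A B) U :
  heart_cone f U -> w_01 w U.
Proof.
case: A B f => [A [leA geA]] [B [leB geB]] f [g [h d]]; split.
  (* The criterion tests maps into [sh U], hence the shifted triangle
     [sh B -> sh U -> sh (sh A)]. *)
  apply/w_ge0_orth => L leL; apply: (orth_extr (rotate (dist_shift d))).
    exact: (w_ge0_orth B).1 geB L leL.
  exact: (w_ge0_orth (sh A)).1 (w_ge0_shift (shifted_shift geA)) L leL.
apply/w_le1_orth => N geN; apply: (orth_extl (rotate d)).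
  exact: (w_le0_orth B).1 leB (sh N) (w_ge0_shift (shifted_shift geN)).
by apply/orth_shift; exact: (w_le0_orth A).1 leA N geN.
Qed.

(** In the weight decomposition, [R -> sh B -> sh U] puts [B] in [w_ge0], and [U -> R -> sh B] puts
    [R] in [w_le1]. Writing [R] as [sh A] up to isomorphism, the connecting map comes from a
    morphism [A -> B]. *)
Lemma w_01_heart_cone U :
  w_01 w U -> exists (A B : heart w) (f : mor A B), heart_cone f U.
Proof.
move=> [geU leU].
have [B [R [a [b [c [leB geR d]]]]]] := w_decomposition w U.
have geB : w_ge0 w B.
  apply/w_ge0_orth => L leL; apply: (orth_extr (rotate (rotate d))).
    exact: (w_ge1_orth R).1 geR L leL.
  exact: (w_ge0_orth U).1 geU L leL.
have [A [leA eA]] : w_le1 w R.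
  apply/w_le1_orth => N geN; apply: (orth_extl (rotate d)).
    exact: (w_le1_orth U).1 leU N geN.
  by apply/orth_shift; exact: (w_le0_orth B).1 leB N geN.
have geA : w_ge0 w A.
  apply/w_ge0_orth => L leL; apply: (orth_isor (isomorphic_sym eA)).
  exact: (w_ge1_orth R).1 geR L leL.
have [e [e' [e'e ee']]] := eA.
(* Rotating the triangle on [f] introduces a sign, which this one cancels. *)
have [f ef] := shift_full (- (c ∘ e')).
exists (exist _ A (conj leA geA)), (exist _ B (conj leB geB)), f, a, (e ∘ b).
apply/dist_rotate; rewrite ef opprK.
apply: (dist_iso d (a := idm B) (b := idm U) (c := e)).
- by exists (idm B); rewrite comp1m.
- by exists (idm U); rewrite comp1m.
- by exists e'.
- by rewrite comp1m compm1.
- by rewrite compm1.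
- by rewrite fmor_id comp1m -compA e'e compm1.
Qed.

Lemma heart_cone_exists (A B : heart w) (f : mor A B) :
  exists U : C01 w, heart_cone f (sval U).
Proof.
have [U cU] := @dist_cone C (sval A) (sval B) f.
by exists (exist _ U (heart_cone_w_01 cU)).
Qed.

Lemma heart_cone_isomorphic (A B A' B' : heart w) (f : mor A B)
    (g : mor A' B') U V :
  heart_cone f U -> heart_cone g V ->
  isomorphic U V <-> arrow_equivalent f g.
Proof.
by apply: (@cone_iso_arrow_equivalent C); apply: heart_orth.
Qed.

End Weights.

(** * Isomorphism classes and the induced bijection *)

Lemma iso_class_eq (B : category) (X Y : B) :
  iso_class X = iso_class Y <-> isomorphic X Y.
Proof.
split=> [/(congr1 sval) /= eXY|eXY].
  by rewrite eXY; apply: isomorphic_refl.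
have e : isomorphic X = isomorphic Y.
  apply/funext => Z; apply/propext; split; apply: isomorphic_trans => //.
  exact: isomorphic_sym.
by apply: eq_exist.
Qed.

Lemma iso_class_surj (B : category) (P : iso_classes B) :
  exists X : B, P = iso_class X.
Proof.
by case: P => p [X eX]; exists X; apply: eq_exist.
Qed.

Theorem proposition2p2p6 (C : triangulated) (w : weight_structure C) :
  (forall U : C, w_01 w U <->
     exists (A B : heart w) (f : mor A B), heart_cone f U)
  /\
  (forall (U V : C) (A B A' B' : heart w) (f : mor A B) (g : mor A' B'),
     w_01 w U -> w_01 w V -> heart_cone f U -> heart_cone g V ->
     (isomorphic U V <->
      homotopy_equivalent (heart_complex f) (heart_complex g)))
  /\
  (forall (C' : triangulated) (w' : weight_structure C')
          (F : functor (heart w) (heart w')),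
     additive_functor F -> is_equivalence F ->
     exists! Ft : iso_classes (C01 w) -> iso_classes (C01 w'),
       bijective Ft /\
       forall (A B : heart w) (s : mor A B) (U : C01 w) (U' : C01 w'),
         heart_cone s (sval U) -> heart_cone (fmor F s) (sval U') ->
         Ft (iso_class U) = iso_class U').
Proof.
split; first split.
- exact: w_01_heart_cone.
- by move=> [A [B [f cf]]]; apply: heart_cone_w_01 cf.
split=> [U V A B A' B' f g _ _ cf cg|C' w' F Fadd Feq].
  rewrite (heart_cone_isomorphic cf cg) two_term_equivalence //.
  exact: heart_zeroP.
(* The graph of the bijection. It is total on both sides by [Rl] and [Rr], and [Req] makes it
   single-valued in both directions. *)
pose R P Q := exists (A B : heart w) (s : mor A B) (U : C01 w) (U' : C01 w'),
  [/\ heart_cone s (sval U), heart_cone (fmor F s) (sval U'),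
      P = iso_class U & Q = iso_class U'].
have Rl P : exists Q, R P Q.
  have [U ->] := iso_class_surj P.
  have [A [B [s cs]]] := w_01_heart_cone (svalP U).
  have [U' cs'] := heart_cone_exists (fmor F s).
  by exists (iso_class U'), A, B, s, U, U'.
have Rr Q : exists P, R P Q.
  have [U' ->] := iso_class_surj Q.
  have [A' [B' [s' cs']]] := w_01_heart_cone (svalP U').
  (* The morphism [s'] is isomorphic, as an arrow, to some [fmor F s], so their cones are
     isomorphic. *)
  have [A [a [a' [a'a aa']]]] := equivalence_ess_surj Feq A'.
  have [B [b [b' [b'b bb']]]] := equivalence_ess_surj Feq B'.
  have [s es] := equivalence_full Feq (b ∘ s' ∘ a').
  have [U cs] := heart_cone_exists s.
  have [V cFs] := heart_cone_exists (fmor F s).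
  exists (iso_class U), A, B, s, U, V; split=> //.
  apply/iso_class_eq; apply/(heart_cone_isomorphic cs' cFs).
  apply: (@arrow_equivalent_iso _ _ _ _ _ _ _ a b).
  - by exists a'.
  - by exists b'.
  - by rewrite es -compA a'a compm1.
(* On each side, equality of classes amounts to homotopy equivalence of arrows, which [F] preserves
   and reflects. *)
have Req P Q P2 Q2 : R P Q -> R P2 Q2 -> P = P2 <-> Q = Q2.
  move=> [A [B [s [U [U' [cs cs' -> ->]]]]]].
  move=> [A2 [B2 [s2 [U2 [U2' [cs2 cs2' -> ->]]]]]].
  rewrite !iso_class_eq.
  apply: (iff_trans (heart_cone_isomorphic cs cs2)).
  apply: (iff_trans _ (iff_sym (heart_cone_isomorphic cs' cs2'))).
  exact: (iff_sym (fmor_arrow_equivalent s s2 Fadd Feq)).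
have [Ft RFt] := choice Rl; have [Gt RGt] := choice Rr.
exists Ft; split; first split.
- exists Gt => [P|Q]; first by apply/(Req _ _ _ _ (RGt _) (RFt P)).
  by apply/(Req _ _ _ _ (RFt _) (RGt Q)).
- move=> A B s U U' cs cs'.
  have RU : R (iso_class U) (iso_class U') by exists A, B, s, U, U'.
  by apply/(Req _ _ _ _ (RFt _) RU).
(* Every class contains the cone of some [s], where the required equation determines the value. *)
move=> Ft' [_ Ft'P]; apply/funext => P.
have [A [B [s [U [U' [cs cs' eP eQ]]]]]] := RFt P.
by rewrite eQ eP (Ft'P _ _ _ _ _ cs cs').
Qed.
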